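(* Let $k\ge 2$ and let $\alpha$ be a node of $\mathcal T_k$. (1) If $\alpha$ is the terminal node of a maximal path $\beta=\gamma_0,\gamma_1,\dots,\gamma_r=\alpha$ in $\mathcal T_k$ (each $\gamma_{t+1}$ a child of $\gamma_t$) such that $i(\beta)>1$ and $i(\gamma_t)=1$ for all $t\ge 1$, and which cannot be extended (i.e. $\alpha$ has no child $\gamma$ with $i(\gamma)=1$), then $A_{i(\alpha)}(\alpha)=0$. (2) If $\alpha=a_{k-1}\cdots a_1$ with $a_{k-1}=1$ and $a_j=0$ for $j=1,\dots,k-2$, then $A_{i(\alpha)}(\alpha)=0$.
   Context: A $k$-germ ($k\ge 2$) is a string $\alpha=a_{k-1}a_{k-2}\cdots a_1$ of nonnegative integers with $a_{k-1}\in\{0,1\}$ and $0\le a_{i-1}\le a_i+1$ for $1<i<k$. For $\alpha\neq 0^{k-1}$ let $i(\alpha)$ be the index of the rightmost nonzero entry of $\alpha$, and let the parent $\beta$ of $\alpha$ be the $k$-germ equal to $\alpha$ except that $b_{i(\alpha)}=a_{i(\alpha)}-1$; this makes the $k$-germs the nodes of a tree $\mathcal T_k$ rooted at $0^{k-1}$ (the children of a node are the germs whose parent it is). The $n$-nest $F(\alpha)$ ($n=2k+1$) is defined recursively along $\mathcal T_k$: $F(0^{k-1})=0\,1\,2\cdots(k-1)\,k\,k\,(k-1)\cdots 2\,1$; for $\alpha\ne 0^{k-1}$ with parent $\beta$ and $i=i(\alpha)$, write $F(\beta)=W^i|M|Z^i$ where $W^i$, $Z^i$ are the leftmost and rightmost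 substrings of length $i$, let $c$ be the leftmost entry of $M$, and split $M=X|Y$ where $Y$ starts at the (leftmost) entry equal to $c+1$ in $M$; then $F(\alpha)=W^i|Y|X|Z^i$. Each $j\in[1,k]$ appears exactly twice in $F(\alpha)$, at positions $p_j<q_j$; the signature entries are $A_j(\alpha)=\lfloor (q_j-p_j)/2\rfloor$ for $j\in[1,k-1]$ (the number of integers both of whose appearances lie strictly between the two appearances of $j$). *)

(* Defs.v *)
From mathcomp Require Import all_boot.

Set Implicit Arguments.
Unset Strict Implicit.
Unset Printing Implicit Defensive.

(* A string a_(k-1) ... a_1 is the sequence [:: a_(k-1); ...; a_1], so entries
   are numbered from the right, starting at 1: entry s i is a_i for
   1 <= i <= size s. *)
Definition entry (s : seq nat) (i : nat) : nat := nth 0 (rev s) i.-1.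

Definition is_germ (k : nat) (s : seq nat) : bool :=
  [&& size s == k.-1,
      entry s k.-1 \in [:: 0; 1]
    & [forall i : 'I_k, (1 < i) ==> (entry s i.-1 <= (entry s i).+1)]].

Definition root_germ (k : nat) : seq nat := nseq k.-1 0.

(* The index i(s) of the rightmost nonzero entry; only meaningful when some
   entry of s is nonzero (otherwise the value is (size s).+1). *)
Definition rnz (s : seq nat) : nat := (find (fun a => a != 0) (rev s)).+1.

Definition parent (s : seq nat) : seq nat :=
  rev (set_nth 0 (rev s) (rnz s).-1 (entry s (rnz s)).-1).

Definition child (k : nat) (b a : seq nat) : bool :=
  [&& is_germ k b, is_germ k a, a != root_germ k & parent a == b].

Definition root_nest (k : nat) : seq nat := iota 0 k.+1 ++ rev (iota 1 k).

(* From W|X|Y|Z to W|Y|X|Z, where W and Z have length i and Y starts at the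
   leftmost c.+1 of X ++ Y, with c the first entry of X ++ Y. *)
Definition castle (i : nat) (f : seq nat) : seq nat :=
  let W := take i f in
  let M := take (size f - i.*2) (drop i f) in
  let Z := drop (size f - i) f in
  let c := head 0 M in
  let X := take (index c.+1 M) M in
  let Y := drop (index c.+1 M) M in
  W ++ Y ++ X ++ Z.

Fixpoint nest_rec (k n : nat) (s : seq nat) : seq nat :=
  if n is m.+1 then castle (rnz s) (nest_rec k m (parent s)) else root_nest k.

(* The depth of a germ in the tree is the sum of its entries; the recursion
   along the tree is given by nest_root and nest_parent. *)
Definition nest (k : nat) (s : seq nat) : seq nat := nest_rec k (sumn s) s.

Lemma nest_root k : nest k (root_germ k) = root_nest k.
Proof. by rewrite /nest sumn_nseq mul0n. Qed.

Lemma has_nonzero k s : is_germ k s -> s != root_germ k ->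
  has (fun a => a != 0) s.
Proof.
case/and3P=> /eqP szs _ _; apply: contraR; rewrite -all_predC => /allP s0.
apply/eqP; rewrite /root_germ -szs; apply/all_pred1P/allP => x /s0 /=.
by rewrite negbK.
Qed.

Lemma sumn_parent k s : is_germ k s -> s != root_germ k ->
  sumn s = (sumn (parent s)).+1.
Proof.
move=> gs s0; have := has_nonzero gs s0.
rewrite /parent /rnz /entry /= sumn_rev -(sumn_rev s) -has_rev.
by elim: (rev s) => //= a t IHt; case: a => [|a] //= /IHt.
Qed.

Lemma nest_parent k s : is_germ k s -> s != root_germ k ->
  nest k s = castle (rnz s) (nest k (parent s)).
Proof. by move=> gs s0; rewrite /nest (sumn_parent gs s0). Qed.

Definition fst_pos (f : seq nat) (j : nat) : nat := index j f.

Definition snd_pos (f : seq nat) (j : nat) : nat :=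
  (fst_pos f j).+1 + index j (drop (fst_pos f j).+1 f).

(* The entry A_j(s) of the signature, for 1 <= j < k: every such j occurs exactly
   twice in nest k s. *)
Definition signature (k : nat) (s : seq nat) (j : nat) : nat :=
  (snd_pos (nest k s) j - fst_pos (nest k s) j) %/ 2.

(* Main.v *)
(* For i = 1 write F(a_(k-1)...a_2 0) = 0 | 1 R 2 | 1.  The word R arises from a
   word N = 2 T, whose other letters are at least 3, by a_2 castlings, each of
   which rotates N cyclically so that the first letter c is replaced by the next
   c + 1.  The castlings at index 1 rotate 1 R 2 in the same way: the first one
   brings the unique 2 of R to the front, and the result is N with "2 1"
   inserted where R begins.  The letters searched for afterwards are at least 3,
   so the next a_2 castlings repeat those that led from N to R and give R 2 1.
   Hence F = 0 R 2 1 1 when a_1 = a_2 + 1, which is what maximality of the path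
   means, and the two 1s are adjacent. *)
Require Import Defs.
From mathcomp Require Import all_boot zify.

Set Implicit Arguments.
Unset Strict Implicit.
Unset Printing Implicit Defensive.

(** * Castling as a rotation of the middle word *)

Definition turn (s : seq nat) : seq nat := rot (index (head 0 s).+1 s) s.

Lemma castle_cat i W M Z : size W = i -> size Z = i ->
  castle i (W ++ M ++ Z) = W ++ turn M ++ Z.
Proof.
move=> sW sZ; rewrite /castle /turn /rot -sW take_size_cat // drop_size_cat //.
have -> : size (W ++ M ++ Z) - (size W).*2 = size M.
  by rewrite !size_cat sZ sW; lia.
have -> : size (W ++ M ++ Z) - size W = size W + size M.
  by rewrite !size_cat sZ sW; lia.
by rewrite take_size_cat // [W ++ M ++ Z]catA drop_size_cat ?size_cat // !catA.
Qed.

(** The prefix P lies inside W and the suffix Q inside Z, so castling only rearranges letters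
    strictly between them. *)
Lemma castle_outer i P T Q :
  size P <= i -> size Q <= i -> i.*2 <= size (P ++ T ++ Q) ->
  exists2 T', perm_eq T' T & castle i (P ++ T ++ Q) = P ++ T' ++ Q.
Proof.
move=> sP sQ si; set f := P ++ T ++ Q in si *.
have szf : size f = size P + size T + size Q by rewrite !size_cat addnA.
have eW : take i f = P ++ take (i - size P) (T ++ Q).
  by rewrite [LHS]take_cat ltnNge sP.
have eZ : drop (size f - i) f = drop (size f - i) (P ++ T) ++ Q.
  have : size P + size T <= size f - i -> size f - i = size P + size T by lia.
  move: (size f - i) => N hN; rewrite [f]catA drop_cat size_cat.
  by case: ltnP => // /hN ->; rewrite subnn drop0 drop_oversize ?size_cat.
have ef : f = take i f ++ take (size f - i.*2) (drop i f) ++ drop (size f - i) f.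
  have -> : size f - i = (size f - i.*2) + i by lia.
  by rewrite -drop_drop !cat_take_drop.
rewrite /castle; move: (take (size f - i.*2) (drop i f)) ef => M ef.
set n := index _ _.
exists (take (i - size P) (T ++ Q) ++ (drop n M ++ take n M)
        ++ drop (size f - i) (P ++ T)); last first.
  by rewrite eW eZ -!catA.
have {}ef : T = take (i - size P) (T ++ Q) ++ M ++ drop (size f - i) (P ++ T).
  move: ef; rewrite eW eZ; set U := take _ _; set V := drop _ _.
  have -> : (P ++ U) ++ M ++ V ++ Q = P ++ (U ++ M ++ V) ++ Q by rewrite -!catA.
  move/eqP.
  rewrite eqseq_cat // eqxx /= => /eqP ef.
  have /eqP := ef; rewrite eqseq_cat; first by case/andP=> /eqP.
  by have := congr1 size ef; rewrite !size_cat; lia.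
rewrite [X in perm_eq _ X]ef perm_cat2l perm_cat2r perm_catC.
by rewrite cat_take_drop.
Qed.

(** * Parents and nests in terms of the last entries *)

Lemma rnz_rconsS s a : rnz (rcons s a.+1) = 1.
Proof. by rewrite /rnz rev_rcons. Qed.

Lemma rnz_rcons0 s : rnz (rcons s 0) = (rnz s).+1.
Proof. by rewrite /rnz rev_rcons. Qed.

Lemma parent_rconsS s a : parent (rcons s a.+1) = rcons s a.
Proof. by rewrite /parent rnz_rconsS /entry rev_rcons /= rev_cons revK. Qed.

Lemma parent_rcons0 s : parent (rcons s 0) = rcons (parent s) 0.
Proof. by rewrite /parent rnz_rcons0 /entry rev_rcons /= rev_cons. Qed.

Lemma rnz_le_size (s : seq nat) : has (fun a : nat => a != 0) s -> rnz s <= size s.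
Proof. by rewrite -has_rev has_find size_rev. Qed.

Lemma size_parent (s : seq nat) : has (fun a => a != 0) s -> size (parent s) = size s.
Proof.
move=> /rnz_le_size; rewrite /parent size_rev size_set_nth size_rev /rnz /=; lia.
Qed.

(** Stated for strings with a nonzero entry rather than for germs, so that the last two entries can
    later take arbitrary values. *)
Lemma sumn_parent_has s : has (fun a => a != 0) s ->
  sumn s = (sumn (parent s)).+1.
Proof.
elim/last_ind: s => // s [|a] IHs; rewrite has_rcons /=.
  by move=> /IHs; rewrite parent_rcons0 -!cats1 !sumn_cat /=; lia.
by rewrite parent_rconsS -!cats1 !sumn_cat /=; lia.
Qed.

Lemma nest_parent_has k s : has (fun a => a != 0) s ->
  nest k s = castle (rnz s) (nest k (parent s)).
Proof. by move=> s0; rewrite /nest (sumn_parent_has s0). Qed.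

Lemma nest_rconsS k s a :
  nest k (rcons s a.+1) = castle 1 (nest k (rcons s a)).
Proof.
by rewrite nest_parent_has ?has_rcons // rnz_rconsS parent_rconsS.
Qed.

Lemma nest_rconsS0 k s a :
  nest k (rcons (rcons s a.+1) 0) = castle 2 (nest k (rcons (rcons s a) 0)).
Proof.
by rewrite nest_parent_has ?has_rcons // rnz_rcons0 rnz_rconsS parent_rcons0
  parent_rconsS.
Qed.

(** Every castling from the root down to such a string has index at least 3, so it fixes the outer
    letters 0 1 2 and 2 1. *)
Lemma nest_rcons00 k s : size s + 3 = k ->
  exists2 T, all (leq 3) T &
    nest k (rcons (rcons s 0) 0) = [:: 0; 1] ++ (2 :: T) ++ [:: 2; 1].
Proof.
move=> sk; pose n := 2 * (k - 2).
suff [T [aT _ ->]] : exists T, [/\ all (leq 3) T, size T = n &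
    nest k (rcons (rcons s 0) 0) = [:: 0; 1] ++ (2 :: T) ++ [:: 2; 1]].
  by exists T.
have [m] := ubnP (sumn s); elim: m s sk => // m IHm s sk sm.
have [s0|s0] := boolP (has (fun a => a != 0) s); last first.
  have es : s = nseq (size s) 0.
    apply/all_pred1P/allP => x xs; apply: contraR s0 => x0.
    by apply/hasP; exists x.
  exists (iota 3 (k - 2) ++ rev (iota 3 (k - 2))); split.
  - by rewrite all_cat all_rev andbb; apply/allP => x; rewrite mem_iota; lia.
  - by rewrite size_cat size_rev size_iota /n; lia.
  have -> : rcons (rcons s 0) 0 = root_germ k.
    rewrite es -!cats1 -catA -[[:: 0] ++ _]/(nseq 2 0) -nseqD /root_germ.
    by congr nseq; lia.
  have [m' ->] : exists m', k = m'.+2 by exists (k - 2); lia.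
  by rewrite nest_root /root_nest subn2 /= !rev_cons -!cats1 -!catA.
have s00 : has (fun a => a != 0) (rcons (rcons s 0) 0) by rewrite !has_rcons s0 !orbT.
have rs := rnz_le_size s0.
have /IHm IH : size (parent s) + 3 = k by rewrite size_parent.
case: IH => [|T [aT sT eT]]; first by have := sumn_parent_has s0; lia.
rewrite nest_parent_has // !rnz_rcons0 !parent_rcons0 eT.
have [|||T' pT ->] := @castle_outer (rnz s).+2 [:: 0; 1; 2] T [:: 2; 1] => //=.
  by rewrite size_cat /= sT /n; lia.
by exists T'; split; rewrite ?(perm_all _ pT) ?(perm_size pT).
Qed.

(** The entry a is raised first, by castlings at index 2 inside 0 1 and 2 1; then b, by castlings at
    index 1 inside 0 and 1. *)
Lemma nest_rcons2 k s a b : size s + 3 = k ->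
  exists2 T, all (leq 3) T &
    nest k (rcons (rcons s a) b) =
      0 :: iter b turn (1 :: iter a turn (2 :: T) ++ [:: 2]) ++ [:: 1].
Proof.
move=> /nest_rcons00[T aT eT]; exists T => //.
have {}eT : nest k (rcons (rcons s a) 0) =
    [:: 0; 1] ++ iter a turn (2 :: T) ++ [:: 2; 1].
  by elim: a => // a IHa; rewrite nest_rconsS0 IHa castle_cat.
elim: b => [|b IHb]; first by rewrite eT /= -catA.
by rewrite nest_rconsS IHb -cat1s castle_cat.
Qed.

(** * Iterated turns with an inserted pair *)

Lemma iter_turn_rot n s : exists r, iter n turn s = rot r s.
Proof.
elim: n => [|n [r IHn]]; first by exists 0; rewrite rot0.
by rewrite iterS IHn /turn rot_rot_add; eexists.
Qed.

Lemma rot_index_cat (x : nat) (A B : seq nat) :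
  rot (index x (A ++ B)) (A ++ B) =
    if x \in A then drop (index x A) A ++ B ++ take (index x A) A
    else drop (index x B) B ++ A ++ take (index x B) B.
Proof.
rewrite /rot index_cat; case: ifP => xA.
  by rewrite drop_cat take_cat index_mem xA -catA.
by rewrite drop_cat take_cat ltnNge leq_addr /= addKn.
Qed.

(* A != [::] keeps the first letter, hence the letter searched for, unaffected by
   the insertion. *)
Lemma iter_turn_insert n A B : all (leq 2) (A ++ B) -> A != [::] ->
  exists A' B', [/\ A' != [::], B' ++ A' = B ++ A,
    iter n turn (A ++ B) = A' ++ B' &
    iter n turn (A ++ [:: 2; 1] ++ B) = A' ++ [:: 2; 1] ++ B'].
Proof.
elim: n A B => [|n IHn] A B AB2 A0; first by exists A, B.
suff [A1 [B1 [A10 e1 e2 e3]]] : exists A1 B1, [/\ A1 != [::],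
    B1 ++ A1 = B ++ A, turn (A ++ B) = A1 ++ B1 &
    turn (A ++ [:: 2; 1] ++ B) = A1 ++ [:: 2; 1] ++ B1].
  rewrite !iterSr e2 e3 -e1; apply: IHn => //.
  by rewrite all_cat andbC -all_cat e1 all_cat andbC -all_cat.
case: A A0 AB2 => // c A _ AB2.
have c2 : 2 <= c by case/andP: AB2.
rewrite /turn [head _ _]/= [head _ _]/= !rot_index_cat.
case: ifP => xA.
  set j := index _ _; exists (drop j (c :: A)), (B ++ take j (c :: A)).
  split.
  - by rewrite -size_eq0 size_drop subn_eq0 -ltnNge index_mem.
  - by rewrite -catA cat_take_drop.
  - by [].
  - by rewrite -!catA.
(* If the searched letter is missing altogether, j is the size of B, [drop j B] is empty and the
   turn is the identity. *)
set j := index _ B; exists (drop j B ++ c :: A), (take j B).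
split.
- by case: (drop j B).
- by rewrite catA cat_take_drop.
- by rewrite -catA.
(* The searched letter c + 1 is at least 3, so it skips the inserted 2 and 1. *)
rewrite index_cat !inE !eqSS (gtn_eqF c2) (gtn_eqF (ltnW c2)) /=.
by rewrite -!catA.
Qed.

Lemma iter_turn_return a T : all (leq 3) T ->
  iter a.+1 turn (1 :: iter a turn (2 :: T) ++ [:: 2]) =
    iter a turn (2 :: T) ++ [:: 2; 1].
Proof.
move=> T3; have T2 : 2 \notin T by apply/negP => /(allP T3).
have [A [B [eT eR]]] : exists A B, T = A ++ B /\
    iter a turn (2 :: T) = B ++ 2 :: A.
  have [[|r] ->] := iter_turn_rot a (2 :: T).
    by exists T, [::]; rewrite rot0 cats0.
  by exists (take r T), (drop r T); rewrite cat_take_drop.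
have /andP[nA nB] : (2 \notin A) && (2 \notin B).
  by rewrite -negb_or -mem_cat -eT.
have eM : turn (1 :: iter a turn (2 :: T) ++ [:: 2]) =
    (2 :: A) ++ [:: 2; 1] ++ B.
  rewrite eR -catA -cat_cons /turn [head _ _]/= rot_index_cat !inE /=.
  by rewrite (negPf nB) -!catA /= ?cats0.
have N2 : all (leq 2) ((2 :: A) ++ B).
  by rewrite /= -eT; apply: sub_all T3 => x /ltnW.
rewrite iterSr eM.
have [//|A' [B' [A'0 e1 e2 ->]]] := @iter_turn_insert a (2 :: A) B N2.
have {}e2 : iter a turn (2 :: T) = A' ++ B' by rewrite eT -e2.
(* Both sides are [iter a turn (2 :: T)]: one by repeating its turns, the other because cutting the
   circular word at the insertion always gives [B ++ 2 :: A]. *)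
have e3 : A' ++ B' = B' ++ A' by rewrite -e2 eR e1.
(* Two commuting words, one letter occurring just once: one of them is empty. *)
have B'0 : B' = [::].
  have c1 : count_mem 2 (A' ++ B') = 1.
    rewrite e3 e1 count_cat /= (count_memPn nA) (count_memPn nB) //.
  (* If the 2 lies in A', its position on the right exceeds that on the left by the size of B',
     which is thus 0; if it lies in B', the same argument would empty A'. *)
  have := congr1 (index 2) e3; rewrite !index_cat.
  move: c1; rewrite count_cat; have [mA|mA] := boolP (2 \in A').
    have: 0 < count_mem 2 A' by rewrite -has_count has_pred1.
    have [mB|mB] := boolP (2 \in B').
      have: 0 < count_mem 2 B' by rewrite -has_count has_pred1.
      by lia.
    by move=> _ _ ?; apply/nilP; rewrite /nilp; lia.
  rewrite (count_memPn mA) add0n => cB.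
  have -> : 2 \in B' by rewrite -has_pred1 has_count cB.
  by move=> ?; case/negP: A'0; rewrite -size_eq0; lia.
by rewrite e2 B'0 !cats0.
Qed.

(** A signature entry is half of this distance rounded down, so adjacent letters give 0. *)
Lemma double_adjacent (f g : seq nat) j : j \notin f ->
  snd_pos (f ++ [:: j, j & g]) j - fst_pos (f ++ [:: j, j & g]) j = 1.
Proof.
move=> jf; rewrite /snd_pos /fst_pos index_cat (negPf jf) /= eqxx addn0.
rewrite drop_cat ltnNge leqnSn /= subSnn /= ?drop0 eqxx; lia.
Qed.

Lemma signature_saturated k s a : size s + 3 = k ->
  signature k (rcons (rcons s a) a.+1) 1 = 0.
Proof.
move=> sk; have [T T3 eT] := nest_rcons2 a a.+1 sk.
rewrite /signature eT iter_turn_return // -catA -cat_cons.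
rewrite -[[:: 2; 1] ++ _]/([:: 2] ++ [:: 1; 1]) catA double_adjacent //.
have [r ->] := iter_turn_rot a (2 :: T).
rewrite mem_cat !inE mem_rot !inE /= orbF.
by apply/negP => /(allP T3).
Qed.

(** * The germ with a single leading 1 *)

Lemma rcons_nseq0 m : rcons (nseq m 0) 0 = nseq m.+1 0.
Proof. by elim: m => //= m ->. Qed.

Lemma rnz_leading m : rnz (1 :: nseq m 0) = m.+1.
Proof.
by elim: m => // m IHm; rewrite -rcons_nseq0 -rcons_cons rnz_rcons0 IHm.
Qed.

(** One castling of the root nest, at index k - 1, turns the middle word k-1 k k into k k k-1, and Z
    starts with the other k-1. *)
Lemma signature_leading k : 2 <= k ->
  signature k (1 :: nseq k.-2 0) k.-1 = 0.
Proof.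
case: k => [|[|m]] //= _.
have er := rnz_leading m.
have ep : parent (1 :: nseq m 0) = root_germ m.+2.
  elim: m {er} => // m IHm.
  by rewrite -rcons_nseq0 -rcons_cons parent_rcons0 IHm /root_germ rcons_nseq0.
rewrite /signature nest_parent_has // er ep nest_root.
have -> : root_nest m.+2 =
    iota 0 m.+1 ++ [:: m.+1; m.+2; m.+2] ++ rev (iota 1 m.+1).
  have e1 : iota 0 m.+3 = iota 0 m.+1 ++ [:: m.+1; m.+2].
    by have := iotaD 0 m.+1 2; rewrite addn2.
  have e2 : iota 1 m.+2 = iota 1 m.+1 ++ [:: m.+2].
    by have := iotaD 1 m.+1 1; rewrite addn1.
  by rewrite /root_nest e1 e2 rev_cat -catA.
have er1 : rev (iota 1 m.+1) = m.+1 :: rev (iota 1 m).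
  by have := iotaD 1 m 1; rewrite addn1 => ->; rewrite rev_cat.
have et : turn [:: m.+1; m.+2; m.+2] = [:: m.+2; m.+2] ++ [:: m.+1].
  by rewrite /turn /= eqxx eqn_leq ltnn andbF.
rewrite castle_cat ?size_rev ?size_iota // et er1 -catA catA cat1s.
by rewrite double_adjacent // mem_cat mem_iota !inE; lia.
Qed.

Lemma entry_rcons2 s a b :
  (entry (rcons (rcons s a) b) 1 = b) * (entry (rcons (rcons s a) b) 2 = a).
Proof. by rewrite /entry !rev_rcons. Qed.

(** While b is at most a, raising it yields a child of index 1; this is what contradicts
    maximality. *)
Lemma germ_last_incr k s a b : is_germ k (rcons (rcons s a) b) -> b <= a ->
  is_germ k (rcons (rcons s a) b.+1).
Proof.
case/and3P=> szs e1 /forallP eS ba.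
have k3 : k.-1 = (size s).+2 by move/eqP: szs; rewrite !size_rcons.
have ee i : 1 < i ->
    entry (rcons (rcons s a) b.+1) i = entry (rcons (rcons s a) b) i.
  by case: i => [|[|i]] // _; rewrite /entry !rev_rcons.
apply/and3P; split; rewrite ?size_rcons ?k3 // -?k3 ?ee ?k3 // -?k3 //.
apply/forallP => i; apply/implyP => i1; rewrite (ee i) //.
have [i2|i2] := ltnP 2 i.
  by rewrite ee; [apply: (implyP (eS i)) | lia].
have -> : i = 2 :> nat by lia.
by rewrite !entry_rcons2.
Qed.

Theorem theorem10 (k : nat) (alpha : seq nat) :
  2 <= k -> is_germ k alpha ->
  (forall (beta : seq nat) (gammas : seq (seq nat)),
      is_germ k beta -> beta != root_germ k -> 1 < rnz beta ->
      path (child k) beta gammas -> last beta gammas = alpha ->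
      (forall gamma, gamma \in gammas -> rnz gamma = 1) ->
      ~ (exists gamma, child k alpha gamma /\ rnz gamma = 1) ->
      signature k alpha (rnz alpha) = 0)
  /\
  (entry alpha k.-1 = 1 ->
   (forall j, 1 <= j <= k - 2 -> entry alpha j = 0) ->
   signature k alpha (rnz alpha) = 0).
Proof.
move=> k2 galpha; split=> [beta gammas gbeta nbeta rbeta _ _ _ maxl|ek ej].
  (* From 1 < i(beta) <= k - 1 comes k >= 3, so alpha has two last entries a and b. *)
  have sbeta := rnz_le_size (has_nonzero gbeta nbeta).
  have /and3P[/eqP szb _ _] := gbeta; have /and3P[/eqP sza _ _] := galpha.
  case/lastP: alpha => [|s b] in galpha maxl sza *; first by rewrite /= in sza; lia.
  case/lastP: s => [|s a] in galpha maxl sza *; first by rewrite /= in sza; lia.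
  have sk : size s + 3 = k by move: sza; rewrite !size_rcons; lia.
  have ab : a < b.
    rewrite ltnNge; apply/negP => ba; apply: maxl.
    exists (rcons (rcons s a) b.+1); rewrite rnz_rconsS; split=> //.
    rewrite /child galpha (germ_last_incr galpha ba) parent_rconsS eqxx andbT /=.
    by apply/eqP=> /(congr1 sumn); rewrite sumn_rcons sumn_nseq; lia.
  (* The germ condition at index 2 gives the opposite bound. *)
  have -> : b = a.+1.
    have k3 : 2 < k by lia.
    case/and3P: galpha => _ _ /forallP/(_ (Ordinal k3)) /=.
    by rewrite !entry_rcons2; lia.
  by rewrite rnz_rconsS signature_saturated.
have -> : alpha = 1 :: nseq k.-2 0.
  have /and3P[/eqP sza _ _] := galpha.
  apply: (can_inj revK); apply: (@eq_from_nth _ 0).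
    by rewrite !size_rev /= size_nseq; lia.
  move=> i; rewrite size_rev sza => ik.
  rewrite rev_cons rev_nseq nth_rcons size_nseq nth_nseq.
  case: ltnP => ik2.
    by have := ej i.+1; rewrite /entry /= => -> //; lia.
  have -> : i = k.-1.-1 by lia.
  by rewrite eqxx; apply: ek.
have -> : rnz (1 :: nseq k.-2 0) = k.-1 by rewrite rnz_leading; lia.
exact: signature_leading.
Qed.
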